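(* Let $(a_n)_{n\ge 1}$ be a sequence of real numbers such that the radius of convergence $R\in[0,\infty]$ of the power series $a(z)=\sum_{n=1}^{\infty}a_nz^n$, given by $\frac1R=\limsup_{n\to\infty}\sqrt[n]{|a_n|}$, satisfies $R>1$. Consider the Volterra difference equation $x_n=\sum_{i=0}^{n-1}a_{n-i}x_i$, $n\ge 1$. Then: (a) The null solution of this equation is stable if and only if the characteristic equation $1-\sum_{n=1}^{\infty}a_nz^n=0$ has no roots in $\{z\in\mathbb{C}:|z|<1\}$ and all its roots (if any) on $|z|=1$ are of order $1$. (b) The null solution of this equation is asymptotically stable if and only if the characteristic equation $1-\sum_{n=1}^{\infty}a_nz^n=0$ has no roots in $\{z\in\mathbb{C}:|z|\le 1\}$.
   Context: A solution of the equation $x_n=\sum_{i=0}^{n-1}a_{n-i}x_i$ ($n\ge1$) is the sequence $(x_n)_{n\ge 0}$ generated recursively from an initial condition $x_0\in\mathbb{R}$. The null solution is the one with $x_0=0$. The null solution is stable if for every $\varepsilon>0$ there is $\delta>0$ such that $|x_0|<\delta$ implies $|x_n|<\varepsilon$ for all $n\ge 0$. It is asymptotically stable if it is stable and there is $\delta>0$ such that $|x_0|<\delta$ implies $x_n\to 0$ as $n\to\infty$. *)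

(* Defs.v *)
From HB Require Import structures.
From mathcomp Require Export all_boot all_order all_algebra complex.
From mathcomp Require Export all_classical all_reals all_analysis.

Set Implicit Arguments.
Unset Strict Implicit.
Unset Printing Implicit Defensive.

Export Order.TTheory GRing.Theory Num.Theory numFieldNormedType.Exports.

Local Open Scope classical_set_scope.
Local Open Scope ring_scope.
Local Open Scope complex_scope.

(* The complex numbers get the topology and norm that the analysis library puts
   on any numFieldType, with scalar field R[i], so that derivatives of functions
   R[i] -> R[i] are complex derivatives. *)
HB.instance Definition _ (R : rcfType) := NormedModule.copy R[i] R[i]^o.

(* Throughout, a coefficient sequence (a_n)_{n >= 1} is a function on nat whose
   value at 0 is never used. *)

(* x^-1 on \bar R satisfies 0^-1 = +oo and +oo^-1 = 0.  The n-th root is the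
   real power 1/n, with 0 `^ (1/n) = 0 for n >= 1; the term n = 0 does not
   affect the limit superior. *)
Definition radius_of_convergence (R : realType) (a : nat -> R) : \bar R :=
  ((limn_esup (fun n => (`|a n| `^ n%:R^-1)%:E))^-1)%E.

Definition is_solution (R : realType) (a x : nat -> R) : Prop :=
  forall n, (1 <= n)%N -> x n = \sum_(i < n) a (n - i)%N * x i.

Definition null_stable (R : realType) (a : nat -> R) : Prop :=
  forall e : R, 0 < e -> exists2 d : R, 0 < d &
    forall x, is_solution a x -> `|x 0%N| < d -> forall n, `|x n| < e.

Definition null_asymptotically_stable (R : realType) (a : nat -> R) : Prop :=
  null_stable a /\
  exists2 d : R, 0 < d &
    forall x, is_solution a x -> `|x 0%N| < d -> x n @[n --> \oo] --> (0 : R).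

(* The infinite sum is the limit of the partial sums in R[i]; it is meaningful
   only where the series converges, in particular for `|z| less than the radius
   of convergence of a. *)
Definition char_fun (R : realType) (a : nat -> R) (z : R[i]) : R[i] :=
  1 - (\big[+%R/0]_(1 <= n <oo) ((a n)%:C * z ^+ n))%BIG.

Definition char_root (R : realType) (a : nat -> R) (z : R[i]) : Prop :=
  char_fun a z = 0.

(* f^`(k) is the k-th complex derivative, and f^`(0) = f. *)
Definition zero_of_order (R : realType) (m : nat) (f : R[i] -> R[i])
    (z : R[i]) : Prop :=
  (forall k, (k < m)%N -> derive1n k f z = 0) /\ derive1n m f z <> 0.

(* Main.v *)
Require Import Defs.
From HB Require Import structures.
From mathcomp Require Import separable cyclic cyclotomic.
From mathcomp Require Import ring lra zify.

Set Implicit Arguments.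
Unset Strict Implicit.
Unset Printing Implicit Defensive.

Import Normc.
Local Notation Re := complex.Re.
Local Notation Im := complex.Im.

Local Open Scope classical_set_scope.
Local Open Scope ring_scope.
Local Open Scope complex_scope.

(** Write f = 1 - a(z) = 1 - a_1 z - a_2 z^2 - ... .  The solution r with
    r_0 = 1 has the formal generating series 1/f, and every solution is a
    multiple of r.  So the null solution is stable iff r is bounded
    ([null_stableP]), asymptotically stable iff r tends to 0
    ([null_asymptotically_stableP]), and the question is how the coefficients
    of 1/f depend on the zeros of f in the closed unit disc, given that the
    coefficients of f decay geometrically.

    Zeros obstruct.  If f(w) = 0 and |w| <= 1, synthetic division gives
    f = (X - w) q, where q decays at the same rate as f ([divide]).  Then
    r * q = 1/(X - w), with coefficients - w^(-n-1) ([quotient_at_zero]).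
    Convolution with q preserves boundedness and convergence to 0, so r is
    unbounded if |w| < 1 ([no_zero_inside]) and does not tend to 0 if |w| = 1
    ([no_zero_on_disc]).  If |w| = 1 and q(w) = 0, divide once more: r * v =
    1/(X - w)^2 has coefficients of modulus n + 1, so r is unbounded
    ([zero_on_circle_simple]).  As q(w) = f'(w) ([derive1_pseries]), this is
    the condition on the order of the zero.

    Absence of zeros suffices.  If f has no zero in the closed disc then, by
    compactness of the disc and the Lipschitz bound for f, |f| >= m > 0 on a
    disc of radius t > 1.  A long truncation p of f satisfies |p| >= m/2 there.
    By factorisation into linear factors, 1/p has geometrically decaying
    coefficients ([poly_inverse]), so the Cauchy estimate, obtained by averaging
    over roots of unity ([cauchy_estimate]), bounds its n-th coefficient by
    (2/m) s^(-n), where s = sqrt t.  The n-th coefficients of 1/p and 1/f agree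
    as soon as p is truncated beyond degree n, and the bound does not depend on
    the truncation; hence r decays geometrically ([inverse_geometric]).

    Simple zeros on the circle are harmless.  They are isolated, hence finitely
    many by compactness.  Remove them one at a time: if f = (X - w) q with
    q(w) <> 0 and q = q(w) + (X - w) t, then
    1/f = (1/(X - w) - t/q) / q(w), which has bounded coefficients if 1/q has
    ([inverse_bounded]). *)

(** * Real-valued modulus and limits of complex sequences *)

(** The norm of R[i] takes values in R[i], which is only partially ordered.
    All estimates below use the real-valued [normc] instead. *)
Lemma norm_normc (R : rcfType) (z : R[i]) : `|z| = (normc z)%:C.
Proof. by []. Qed.

(** [le_normcD] and [normcN] speak of the alias [Rcomplex R], whose addition is
    not syntactically that of R[i]; this form and the next can be rewritten with. *)
Lemma normcD (R : rcfType) (x y : R[i]) : normc (x + y) <= normc x + normc y.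
Proof. exact: le_normcD. Qed.

Lemma normcNC (R : rcfType) (x : R[i]) : normc (- x) = normc x.
Proof. exact: normcN. Qed.

Lemma normcB (R : rcfType) (x y : R[i]) : normc (x - y) = normc (y - x).
Proof. by rewrite -normcNC opprB. Qed.

Lemma normc_ge0 (R : rcfType) (z : R[i]) : 0 <= normc z.
Proof. by case: z => x y; rewrite /normc sqrtr_ge0. Qed.

Lemma normcX (R : rcfType) (z : R[i]) n : normc (z ^+ n) = normc z ^+ n.
Proof. by elim: n => [|n IH]; rewrite ?expr0 ?normc1// !exprS normcM IH. Qed.

Lemma normcR (R : rcfType) (x : R) : normc x%:C = `|x|.
Proof. by rewrite /normc /= expr0n /= addr0 sqrtr_sqr. Qed.

Lemma normc_sum (R : rcfType) (I : Type) (s : seq I) (P : pred I) (F : I -> R[i]) :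
  normc (\sum_(i <- s | P i) F i) <= \sum_(i <- s | P i) normc (F i).
Proof.
elim: s => [|i s IH]; first by rewrite !big_nil normc0.
rewrite !big_cons; case: ifP => // _.
by apply: (le_trans (normcD _ _)); rewrite lerD2l.
Qed.

Lemma ler_normcB (R : rcfType) (x y : R[i]) : normc x - normc y <= normc (x - y).
Proof. by rewrite lerBlDr -{1}(subrK y x) normcD. Qed.

Lemma normc_gt0 (R : rcfType) (z : R[i]) : (0 < normc z) = (z != 0).
Proof.
rewrite lt_def normc_ge0 andbT; congr negb; apply/eqP/eqP => [/eq0_normc//|->].
exact: normc0.
Qed.

Lemma normc_Re (R : rcfType) (z : R[i]) : `|Re z| <= normc z.
Proof. by rewrite -lecR; exact: normc_ge_Re. Qed.

Lemma normc_Im (R : rcfType) (z : R[i]) : `|Im z| <= normc z.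
Proof.
case: z => x y /=.
by rewrite -sqrtr_sqr ler_wsqrtr// lerDr sqr_ge0.
Qed.

Lemma normc_ReIm (R : rcfType) (x y : R) : normc (x +i* y) <= `|x| + `|y|.
Proof.
rewrite [x +i* y]complexE; apply: (le_trans (normcD _ _)).
rewrite normcR lerD2l normcM normcR.
by rewrite {1}/normc expr0n /= add0r expr1n sqrtr1 mul1r.
Qed.

Section CvgC.
Variable R : realType.
Implicit Types (u : nat -> R[i]).

(** Only positive real radii matter: a positive element of R[i] is real. *)
Lemma cvgCP u (l : R[i]) : (u @ \oo --> l) <->
  forall e : R, 0 < e -> exists n0, forall n, (n0 <= n)%N -> normc (l - u n) <= e.
Proof.
split=> [/cvgrPdist_le ul e e0|H].
  have /ul [n0 _ Hn] : 0 < e%:C :> R[i] by rewrite ltcR.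
  by exists n0 => n nn; have := Hn n nn; rewrite norm_normc lecR.
apply/cvgrPdist_le => e.
case: e => e e'; rewrite ltcE /= => /andP[/eqP -> e0].
have [n0 Hn] := H e e0; exists n0 => // n /= nn.
by rewrite norm_normc lecE /= eqxx Hn.
Qed.

Lemma cvgRP (u : nat -> R) (l : R) : (u @ \oo --> l) <->
  forall e : R, 0 < e -> exists n0, forall n, (n0 <= n)%N -> `|l - u n| <= e.
Proof.
split=> [/cvgrPdist_le ul e e0|H]; first by have [n0 _ Hn] := ul e e0; exists n0.
by apply/cvgrPdist_le => e /H[n0 Hn]; exists n0.
Qed.

Lemma cauchyR (u : nat -> R) (b : nat -> R) : b @ \oo --> 0 ->
  (forall n m, (n <= m)%N -> `|u m - u n| <= b n) -> exists l : R, u @ \oo --> l.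
Proof.
move=> /cvgRP b0 ub.
apply/cvg_ex; apply: cauchy_cvg; apply/cauchy_ballP => e e0.
have [n0 Hn] := b0 (e / 2 / 2) ltac:(by rewrite !divr_gt0).
have bb := Hn n0 (leqnn _); rewrite sub0r normrN in bb.
exists (u @` [set n | (n0 <= n)%N], u @` [set n | (n0 <= n)%N]) => /=.
  by split; exists n0 => // n nn; exists n.
move=> [x y] [/= [n nn <-] [m mm <-]] /=.
rewrite /ball /=.
have h1 := ub _ _ nn; have h2 := ub _ _ mm.
have h3 : b n0 <= e / 2 / 2 by apply: le_trans bb; exact: ler_norm.
have := ler_normD (u n - u n0) (u n0 - u m).
rewrite addrA subrK (distrC (u n0)) => h4.
lra.
Qed.

(** Completeness of R[i], read off from that of R on real and imaginary parts,
    together with the resulting error bound for the limit. *)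
Lemma cauchyC u (b : nat -> R) : b @ \oo --> 0 ->
  (forall n m, (n <= m)%N -> normc (u m - u n) <= b n) ->
  exists2 l : R[i], u @ \oo --> l & forall n, normc (l - u n) <= b n.
Proof.
move=> b0 ub.
have [x xu] : exists l : R, (fun n => Re (u n)) @ \oo --> l.
  apply: (cauchyR b0) => n m nm; apply: le_trans (ub _ _ nm).
  by rewrite -raddfB; exact: normc_Re.
have [y yu] : exists l : R, (fun n => Im (u n)) @ \oo --> l.
  apply: (cauchyR b0) => n m nm; apply: le_trans (ub _ _ nm).
  by rewrite -raddfB; exact: normc_Im.
have ul : u @ \oo --> x +i* y.
  apply/cvgCP => e e0; have e2 : 0 < e / 2 by rewrite divr_gt0.
  have [n1 H1] := (cvgRP _ _).1 xu _ e2; have [n2 H2] := (cvgRP _ _).1 yu _ e2.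
  exists (maxn n1 n2) => n; rewrite geq_max => /andP[/H1 h1 /H2 h2].
  move: h1 h2 => /=; case: (u n) => p q /= h1 h2.
  apply: (le_trans (normc_ReIm (x - p) (y - q))); lra.
exists (x +i* y) => // n; apply/ler_addgt0Pr => e e0.
have [n0 H0] := (cvgCP _ _).1 ul e e0.
have := H0 _ (leq_maxl n0 n); have := ub _ _ (leq_maxr n0 n).
have := normcD (x +i* y - u (maxn n0 n)) (u (maxn n0 n) - u n).
by rewrite addrA subrK; lra.
Qed.

End CvgC.

(** * Formal power series as coefficient sequences *)

Section FormalSeries.
Variable F : fieldType.
Implicit Types u v t : nat -> F.

(** Cauchy product: the product of formal power series. *)
Definition conv u v n := \sum_(i < n.+1) u i * v (n - i)%N.

(** The coefficients of the constant series 1. *)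
Definition conv_one n : F := (n == 0%N)%:R.

(** The coefficients of (X - w) u, where u stands for the series with
    coefficients u. *)
Definition mulXsub (w : F) u n := (if n is m.+1 then u m else 0) - w * u n.

Lemma conv_one0 : conv_one 0 = 1. Proof. by []. Qed.
Lemma conv_oneS n : conv_one n.+1 = 0. Proof. by []. Qed.

(** A coefficient of a product of series depends only on finitely many
    coefficients of the factors, so the ring laws for series follow from those
    for truncations, which are polynomials. *)
Lemma conv_poly u v n m : (m <= n)%N ->
  conv u v m = ((\poly_(i < n.+1) u i) * (\poly_(i < n.+1) v i))`_m.
Proof.
move=> mn; rewrite coefM; apply: eq_bigr => i _; rewrite !coef_poly.
have hi : (i < n.+1)%N by rewrite (leq_trans (ltn_ord i)).
by rewrite hi (leq_ltn_trans (leq_subr _ _)).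
Qed.

Lemma convC u v : conv u v = conv v u.
Proof. by apply/funext => n; rewrite !(@conv_poly _ _ n)// mulrC. Qed.

Lemma conv_agree u u' v v' n : (forall k, (k <= n)%N -> u k = u' k) ->
  (forall k, (k <= n)%N -> v k = v' k) -> conv u v n = conv u' v' n.
Proof.
move=> uu vv; apply: eq_bigr => i _; rewrite uu -1?ltnS//.
by rewrite vv// leq_subr.
Qed.

Lemma convA u v t : conv u (conv v t) = conv (conv u v) t.
Proof.
apply/funext => n.
pose P w := \poly_(i < n.+1) w i : {poly F}.
have PE w k : (k <= n)%N -> w k = (P w)`_k by move=> kn; rewrite coef_poly ltnS kn.
rewrite (@conv_agree u (fun k => (P u)`_k) _ (fun k => (P v * P t)`_k) n); first last.
- by move=> k kn; exact: conv_poly.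
- exact: PE.
rewrite (@conv_agree (conv u v) (fun k => (P u * P v)`_k) _ (fun k => (P t)`_k) n);
  first last.
- exact: PE.
- by move=> k kn; exact: conv_poly.
by rewrite /conv -!coefM mulrA.
Qed.

Lemma conv1 u : conv u conv_one = u.
Proof.
apply/funext => n; rewrite /conv big_ord_recr/= subnn mulr1.
rewrite big1 ?add0r// => i _; rewrite /conv_one subn_eq0 leqNgt ltn_ord mulr0.
by [].
Qed.

Lemma mulXsub_conv w u : mulXsub w u = conv (mulXsub w conv_one) u.
Proof.
apply/funext => -[|n]; first by rewrite /conv big_ord1/= /mulXsub/= mulr1 !sub0r mulNr.
rewrite /conv big_ord_recl big_ord_recl /mulXsub /= big1 ?addr0; last first.
  by move=> i _; rewrite /bump/= /conv_one/= mulr0 subr0 mul0r.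
by rewrite /conv_one/= /bump/= mulr0 subr0 mulr1 sub0r mulNr mul1r subn1 addrC.
Qed.

Lemma conv_mulXsub w u v : conv u (mulXsub w v) = mulXsub w (conv u v).
Proof. by rewrite mulXsub_conv (mulXsub_conv w (conv _ _)) [conv u _]convC -convA (convC v). Qed.

Lemma mulXsubC (w z : F) u : mulXsub w (mulXsub z u) = mulXsub z (mulXsub w u).
Proof. by apply/funext => -[|[|n]]; rewrite /mulXsub; ring. Qed.

Lemma inverse_uniq u v f : conv u f = conv_one -> conv v f = conv_one -> u = v.
Proof.
move=> uf vf; rewrite -(conv1 u) -vf convA (convC u) -convA uf.
by rewrite conv1.
Qed.

(** The n-th coefficient of 1/f is determined by the coefficients of f up to n.
    This allows f to be replaced by a polynomial truncation. *)
Lemma inverse_agree u v f g n : (forall k, (k <= n)%N -> f k = g k) ->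
  conv u f = conv_one -> conv v g = conv_one -> u n = v n.
Proof.
move=> fg uf vg; rewrite -[u]conv1 -vg convA (convC u) -convA.
rewrite (@conv_agree _ v _ (conv u f) n) ?uf ?conv1// => k kn.
by rewrite -uf; apply: conv_agree => // j jk; rewrite fg// (leq_trans jk).
Qed.

(** Course-of-values recursion: [L n] is the list of the first n + 1 values. *)
Lemma volterra_exists (a : nat -> F) : exists2 x : nat -> F, x 0%N = 1 &
  forall n, x n.+1 = \sum_(i < n.+1) a (n.+1 - i)%N * x i.
Proof.
pose G (s : seq F) := \sum_(i < size s) a (size s - i)%N * s`_i.
pose L := fix L n := if n is m.+1 then rcons (L m) (G (L m)) else [:: 1].
pose x n := last 0 (L n).
have LE n : L n = mkseq x n.+1.
  by elim: n => [//|n IH]; rewrite mkseqS -IH /x/= last_rcons.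
exists x => // n; rewrite {1}/x/= last_rcons LE /G size_mkseq.
by apply: eq_bigr => i _; rewrite nth_mkseq.
Qed.

(** The coefficients of 1 - a(z). *)
Definition char_coef (a : nat -> F) n := if n is 0%N then 1 else - a n.

(** The Volterra recursion says exactly that x is the inverse of 1 - a(z). *)
Lemma conv_char_coef (a x : nat -> F) : x 0%N = 1 ->
  (forall n, x n.+1 = \sum_(i < n.+1) a (n.+1 - i)%N * x i) ->
  conv x (char_coef a) = conv_one.
Proof.
move=> x0 xS; apply/funext => -[|n]; first by rewrite /conv big_ord1/= x0 mulr1.
rewrite /conv big_ord_recr/= subnn mulr1 xS -big_split/= big1// => i _.
rewrite subSn -1?ltnS//= mulrN mulrC addNr.
by [].
Qed.

Lemma inverse_exists f : f 0%N != 0 -> exists u, conv u f = conv_one.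
Proof.
move=> f0; have [x x0 xS] := volterra_exists (fun n => - (f n / f 0%N)).
(* After division by its constant coefficient, f has the form 1 - a(z). *)
exists (fun n => (f 0%N)^-1 * x n).
rewrite -[RHS](@conv_char_coef (fun n => - (f n / f 0%N)) x x0 xS).
apply/funext => n; apply: eq_bigr => i _.
rewrite mulrAC mulrC; congr (_ * _); case: (n - i)%N => [|m] /=; first by rewrite mulVf.
by rewrite opprK mulrC.
Qed.

End FormalSeries.
Arguments conv_one {F}.

Section Bounds.
Variable R : realType.
Implicit Types (u v : nat -> R[i]) (rho M B q : R).

(** Cauchy's coefficient bound for a function bounded by M on the disc of radius
    rho; it stands for a radius of convergence at least rho, with the constant
    kept explicit so that estimates are uniform. *)
Definition geo_bound rho M u := forall n, normc (u n) * rho ^+ n <= M.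

Lemma geo_bound_ge0 rho M u : geo_bound rho M u -> 0 <= M.
Proof. by move=> /(_ 0%N); rewrite expr0 mulr1; apply: le_trans; exact: normc_ge0. Qed.

Lemma geo_boundE rho M u n : 0 < rho -> geo_bound rho M u -> normc (u n) <= M * rho^-1 ^+ n.
Proof. by move=> r0 /(_ n); rewrite exprVn ler_pdivlMr ?exprn_gt0. Qed.

Lemma geo_bound_mulXsub rho M (w : R[i]) u : 0 < rho -> geo_bound rho M u ->
  geo_bound rho (M * rho + normc w * M) (mulXsub w u).
Proof.
move=> r0 uM n; have rn : 0 <= rho ^+ n by rewrite exprn_ge0// ltW.
apply: (le_trans (ler_wpM2r rn (normcD _ _))); rewrite mulrDl lerD//.
  case: n rn => [|n] _; first by rewrite normc0 mul0r mulr_ge0 ?(geo_bound_ge0 uM)// ltW.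
  by rewrite exprSr mulrA ler_wpM2r// ltW.
by rewrite normcNC normcM -mulrA ler_wpM2l ?normc_ge0.
Qed.

Lemma geo_sum q n m : 0 <= q -> q < 1 ->
  \sum_(n <= i < m) q ^+ i <= q ^+ n / (1 - q).
Proof.
move=> q0 q1; have q1' : 0 < 1 - q by rewrite subr_gt0.
have [mn|nm] := leqP m n.
  by rewrite big_geq// divr_ge0 ?exprn_ge0// ltW.
rewrite ler_pdivlMr// mulr_suml.
rewrite (eq_bigr (fun i => - q ^+ i.+1 - - q ^+ i)) => [|i _].
  rewrite (telescope_sumr (fun i => - q ^+ i) (ltnW nm)) opprK addrC.
  by rewrite lerBlDr lerDl exprn_ge0.
by rewrite mulrBr mulr1 -exprSr opprK addrC.
Qed.

(** For rho > 1 the sequence v is summable, and convolution with a summable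
    sequence preserves boundedness. *)
Lemma conv_bounded B rho M u v : 1 < rho -> (forall n, normc (u n) <= B) ->
  geo_bound rho M v -> forall n, normc (conv u v n) <= B * (M / (1 - rho^-1)).
Proof.
move=> r1 uB vM n; have r0 : 0 < rho by apply: lt_trans r1.
rewrite convC; apply: (le_trans (normc_sum _ _ _)).
have h : \sum_(i < n.+1) (rho^-1 ^+ i) <= (1 - rho^-1)^-1.
  rewrite -(big_mkord xpredT (fun i => rho^-1 ^+ i)).
  have := @geo_sum rho^-1 0 n.+1; rewrite expr0 mul1r; apply.
    by rewrite invr_ge0 ltW.
  by rewrite invf_lt1.
have B0 : 0 <= B by apply: le_trans (uB 0%N); exact: normc_ge0.
have M0 := geo_bound_ge0 vM.
apply: (@le_trans _ _ (\sum_(i < n.+1) (B * (M * rho^-1 ^+ i)))).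
  apply: ler_sum => i _; rewrite normcM mulrC ler_pM ?normc_ge0//.
  exact: geo_boundE.
by rewrite -!mulr_sumr !ler_wpM2l.
Qed.

(** Likewise for convergence to 0.  The majorant
    T n = |u_n| + q |u_(n-1)| + q^2 |u_(n-2)| + ... satisfies
    T (n+1) = q T n + |u_(n+1)|; once |u| is at most d, it decays geometrically
    down to d / (1 - q). *)
Lemma conv_cvg0 rho M u v : 1 < rho -> u @ \oo --> (0 : R[i]) ->
  geo_bound rho M v -> conv u v @ \oo --> (0 : R[i]).
Proof.
move=> r1 u0 vM; have r0 : 0 < rho by apply: lt_trans r1.
pose q := rho^-1; have q0 : 0 < q by rewrite invr_gt0.
have q1 : q < 1 by rewrite invf_lt1.
have q1' : 0 < 1 - q by rewrite subr_gt0.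
have M0 := geo_bound_ge0 vM.
pose T n := \sum_(i < n.+1) normc (u i) * q ^+ (n - i).
have TS n : T n.+1 = q * T n + normc (u n.+1).
  rewrite /T big_ord_recr/= subnn mulr1; congr (_ + _).
  rewrite mulr_sumr; apply: eq_bigr => i _.
  by rewrite subSn -1?ltnS// exprS mulrCA.
have T0 n : 0 <= T n.
  by apply: sumr_ge0 => i _; rewrite mulr_ge0 ?normc_ge0// exprn_ge0// ltW.
have uT n : normc (conv u v n) <= M * T n.
  apply: (le_trans (normc_sum _ _ _)); rewrite mulr_sumr; apply: ler_sum => i _.
  by rewrite normcM mulrCA ler_wpM2l ?normc_ge0//; exact: geo_boundE.
apply/cvgCP => e e0.
have M1 : 0 < M + 1 by rewrite ltr_wpDl.
pose d := e / (M + 1) / 2 * (1 - q).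
have d0 : 0 < d by rewrite /d !mulr_gt0 ?invr_gt0.
have [n0 Hn0] := (cvgCP _ _).1 u0 _ d0.
have TB k : T (n0 + k)%N <= q ^+ k * T n0 + e / (M + 1) / 2.
  elim: k => [|k IH].
    by rewrite addn0 expr0 mul1r lerDl !mulr_ge0 ?invr_ge0 ?ltW.
  rewrite addnS TS; have := Hn0 (n0 + k).+1 ltac:(lia).
  rewrite sub0r normcNC => h; have := ler_wpM2l (ltW q0) IH.
  rewrite exprS /d in h *; nra.
have [n1 Hn1] : exists n1, forall k, (n1 <= k)%N -> q ^+ k * T n0 <= e / (M + 1) / 2.
  have /cvgRP : geometric (T n0) q @ \oo --> (0 : R).
    by apply: cvg_geometric; rewrite ger0_norm// ltW.
  move=> /(_ (e / (M + 1) / 2)) [|n1 Hn1]; first by rewrite !mulr_gt0 ?invr_gt0.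
  exists n1 => k /Hn1; rewrite sub0r normrN => h; apply: le_trans h.
  by rewrite mulrC ler_norm.
exists (n0 + n1)%N => n nn; rewrite sub0r normcNC.
apply: (le_trans (uT n)); rewrite -(subnKC (leq_trans (leq_addr _ _) nn)).
set k := (n - n0)%N; have := TB k; have := Hn1 k ltac:(rewrite /k; lia) => h1 h2.
have h3 : T (n0 + k)%N <= e / (M + 1) by lra.
apply: (@le_trans _ _ ((M + 1) * T (n0 + k)%N)); first by rewrite ler_wpM2r// lerDl.
by rewrite mulrC -ler_pdivlMr.
Qed.

End Bounds.

(** * Power series with geometrically decaying coefficients *)

Definition psum (R : realType) (u : nat -> R[i]) z n := \sum_(0 <= k < n) u k * z ^+ k.

(** Locked, since unification would otherwise unfold the limit when it compares
    the values at two different points. *)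
HB.lock Definition pseries (R : realType) (u : nat -> R[i]) (z : R[i]) : R[i] :=
  limn (psum u z).

Section PowerSeries.
Variable R : realType.
Implicit Types (u f : nat -> R[i]) (z w : R[i]) (rho M B s : R).

Lemma psumS u z n : psum u z n.+1 = psum u z n + u n * z ^+ n.
Proof. by rewrite /psum big_nat_recr. Qed.

Lemma pseries_eq u z l : psum u z @ \oo --> l -> pseries u z = l.
Proof. by rewrite unlock => /cvg_lim; apply; exact: norm_hausdorff. Qed.

Lemma ratio_bounds s rho : 0 <= s -> s < rho -> [/\ 0 < rho, 0 <= s / rho & s / rho < 1].
Proof.
move=> s0 sr; have r0 : 0 < rho by apply: le_lt_trans sr.
by rewrite r0 divr_ge0// ?ltW// ltr_pdivrMr// mul1r.
Qed.

Lemma psum_tail rho M s u z n m : geo_bound rho M u -> normc z <= s -> s < rho ->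
  (n <= m)%N ->
  normc (psum u z m - psum u z n) <= M * ((s / rho) ^+ n / (1 - s / rho)).
Proof.
move=> uM zs sr nm; have s0 : 0 <= s by apply: le_trans zs; exact: normc_ge0.
have [r0 q0 q1] := ratio_bounds s0 sr.
have -> : psum u z m - psum u z n = \sum_(n <= k < m) u k * z ^+ k.
  by rewrite /psum (big_cat_nat (leq0n n) nm)/= addrAC subrr add0r.
apply: (le_trans (normc_sum _ _ _)).
apply: (@le_trans _ _ (\sum_(n <= k < m) M * (s / rho) ^+ k)); last first.
  by rewrite -mulr_sumr ler_wpM2l ?geo_sum//; exact: geo_bound_ge0 uM.
apply: ler_sum => k _; rewrite normcM normcX exprMn mulrCA mulrC.
rewrite ler_pM ?exprn_ge0 ?normc_ge0//; last exact: geo_boundE.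
by rewrite lerXn2r ?nnegrE ?normc_ge0.
Qed.

Lemma psum_cvg rho M s u z : geo_bound rho M u -> normc z <= s -> s < rho ->
  psum u z @ \oo --> pseries u z /\
  forall n, normc (pseries u z - psum u z n) <= M * ((s / rho) ^+ n / (1 - s / rho)).
Proof.
move=> uM zs sr; have s0 : 0 <= s by apply: le_trans zs; exact: normc_ge0.
have [r0 q0 q1] := ratio_bounds s0 sr.
have [|n m nm|l ul lb] := @cauchyC R (psum u z)
    (fun n => M * ((s / rho) ^+ n / (1 - s / rho))).
- have : geometric (M / (1 - s / rho)) (s / rho) @ \oo --> (0 : R).
    by apply: cvg_geometric; rewrite ger0_norm.
  apply: cvg_trans; apply: near_eq_cvg; near=> n => /=.
  by rewrite mulrAC mulrA.
- exact: psum_tail uM zs sr nm.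
by rewrite (pseries_eq ul).
Unshelve. all: by end_near. Qed.

Lemma pseries_bound rho M s u z : geo_bound rho M u -> normc z <= s -> s < rho ->
  normc (pseries u z) <= M / (1 - s / rho).
Proof.
move=> uM zs sr; have [_ /(_ 0%N)] := psum_cvg uM zs sr.
by rewrite /psum big_geq// subr0 expr0 mul1r.
Qed.

(** The partial sums of (X - w) u telescope to those of u, up to one boundary
    term that tends to 0 inside the disc of convergence. *)
Lemma psum_mulXsub w u z n :
  psum (mulXsub w u) z n.+1 = (z - w) * psum u z n - w * (u n * z ^+ n).
Proof.
elim: n => [|n IH].
  by rewrite psumS /psum !big_geq// /mulXsub/= expr0; ring.
by rewrite psumS IH psumS /mulXsub exprS; ring.
Qed.

Lemma pseries_mulXsub rho M w u z : geo_bound rho M u -> normc z < rho ->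
  pseries (mulXsub w u) z = (z - w) * pseries u z.
Proof.
move=> uM zr; have [uP _] := psum_cvg uM (lexx _) zr.
apply: pseries_eq; rewrite -cvg_shiftS.
have h0 : (fun n => u n * z ^+ n) @ \oo --> (0 : R[i]).
  have -> : (fun n => u n * z ^+ n) = (fun n => psum u z n.+1 - psum u z n).
    by apply/funext => n; rewrite psumS addrC addKr.
  rewrite -(subrr (pseries u z)); apply: cvgB => //.
  by rewrite (cvg_shiftS (psum u z)).
rewrite (_ : (fun n => _) = (fun n => (z - w) * psum u z n - w * (u n * z ^+ n)));
  last by apply/funext => n; rewrite psum_mulXsub.
have -> : (z - w) * pseries u z = (z - w) * pseries u z - w * 0.
  by rewrite mulr0 subr0.
exact: (cvgB (cvgM (cvg_cst _) uP) (cvgM (cvg_cst _) h0)).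
Qed.

Lemma pseries_addC rho M u c z : geo_bound rho M u -> normc z < rho ->
  pseries (fun n => u n + c * conv_one n) z = pseries u z + c.
Proof.
move=> uM zr; have [uP _] := psum_cvg uM (lexx _) zr.
apply: pseries_eq; rewrite -cvg_shiftS.
rewrite (_ : (fun n => _) = (fun n => psum u z n.+1 + c)).
  apply: cvgD; last exact: cvg_cst.
  by rewrite (cvg_shiftS (psum u z)).
apply/funext => n; rewrite /psum big_nat_recl//= [in RHS]big_nat_recl//=.
rewrite /conv_one/= mulrDl expr0 !mulr1 -!addrA; congr (_ + _).
rewrite addrC; congr (_ + _); apply: eq_bigr => i _.
by rewrite mulr0 addr0.
Qed.

Lemma pseries_shift rho M u z : geo_bound rho M u -> normc z < rho ->
  pseries u z = u 0%N + z * pseries (fun n => u n.+1) z.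
Proof.
move=> uM zr.
have r0 : 0 < rho by apply: le_lt_trans zr; exact: normc_ge0.
have vM : geo_bound rho (M / rho) (fun n => u n.+1).
  by move=> n; rewrite ler_pdivlMr// -mulrA -exprSr; exact: uM.
have [vP _] := psum_cvg vM (lexx _) zr.
apply: pseries_eq; rewrite -cvg_shiftS.
rewrite (_ : (fun n => _) = (fun n => u 0%N + z * psum (fun n => u n.+1) z n)).
  exact: (cvgD (cvg_cst _) (cvgM (cvg_cst _) vP)).
apply/funext => n; rewrite /psum big_nat_recl//= expr0 mulr1; congr (_ + _).
by rewrite mulr_sumr; apply: eq_bigr => i _; rewrite exprS mulrCA.
Qed.

(** Synthetic division by X - w.  The quotient has the coefficients
    q_n = f_(n+1) + f_(n+2) w + f_(n+3) w^2 + ..., so it decays like f, with a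
    constant that depends on w only through a bound s < rho for |w|. *)
Lemma divide rho M s f w : geo_bound rho M f -> normc w <= s -> s < rho ->
  exists2 q, geo_bound rho (M / (rho - s)) q &
    f = fun n => mulXsub w q n + pseries f w * conv_one n.
Proof.
move=> fM ws sr; have s0 : 0 <= s by apply: le_trans ws; exact: normc_ge0.
have [r0 q0 q1] := ratio_bounds s0 sr; have wr := le_lt_trans ws sr.
have shM n : geo_bound rho (M * rho^-1 ^+ n) (fun j => f (n + j)%N).
  move=> j; rewrite exprVn ler_pdivlMr ?exprn_gt0// -mulrA -exprD addnC.
  exact: fM.
pose q n := pseries (fun j => f (n.+1 + j)%N) w.
exists q => [n|].
  have := pseries_bound (shM n.+1) ws sr; rewrite -/(q n) => h.
  apply: (le_trans (ler_wpM2r _ h)); first by rewrite exprn_ge0// ltW.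
  rewrite exprS exprVn le_eqVlt; apply/orP; left; apply/eqP; field.
  by rewrite !gt_eqF ?exprn_gt0 ?subr_gt0.
apply/funext => -[|n]; rewrite /conv_one/= /mulXsub/=.
  rewrite mulr1 sub0r (pseries_shift fM wr) -/(q 0%N) addrC -addrA subrr addr0.
  by [].
rewrite mulr0 addr0 /q (pseries_shift (shM n.+1) wr) addn0.
under [in X in _ - X]eq_fun do rewrite addSnnS.
by rewrite addrK.
Qed.

(** f(z) - f(w) = (z - w) q(z), where the quotient q is bounded uniformly in w. *)
Lemma pseries_lipschitz rho M s f z w : geo_bound rho M f ->
  normc z <= s -> normc w <= s -> s < rho ->
  normc (pseries f z - pseries f w) <=
    M / (rho - s) / (1 - s / rho) * normc (z - w).
Proof.
move=> fM zs ws sr; have [q qM fE] := divide fM ws sr.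
have zr := le_lt_trans zs sr.
have r0 : 0 < rho by rewrite (le_lt_trans _ zr)// normc_ge0.
have l'M := geo_bound_mulXsub w r0 qM.
rewrite {1}fE (pseries_addC _ l'M zr) addrK (pseries_mulXsub w qM zr).
by rewrite normcM mulrC ler_wpM2r ?normc_ge0//; exact: pseries_bound qM zs sr.
Qed.

(** The difference quotient of (z - w) q(z) at w is q, which is continuous.  The
    function g is only constrained inside the disc: a sum defined as a limit has
    an unspecified value where the series diverges. *)
Lemma derive1_pseries rho M q w (g : R[i] -> R[i]) : geo_bound rho M q ->
  normc w < rho ->
  (forall z, normc z < rho -> g z = (z - w) * pseries q z) ->
  derive1 g w = pseries q w.
Proof.
move=> qM wr gE; rewrite /derive1; apply: cvg_lim; first exact: norm_hausdorff.
pose s := (normc w + rho) / 2.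
have ws : normc w < s by rewrite /s; lra.
have sr : s < rho by rewrite /s; lra.
pose L := M / (rho - s) / (1 - s / rho).
have L0 : 0 <= L.
  have s0 : 0 <= s by apply: le_trans (ltW ws); exact: normc_ge0.
  have [_ _ q1] := ratio_bounds s0 sr.
  by rewrite /L divr_ge0 ?divr_ge0 ?subr_ge0 ?(ltW sr) ?(ltW q1) ?(geo_bound_ge0 qM).
apply/cvgrPdist_le => e; case: e => e e'; rewrite ltcE /= => /andP[/eqP -> e0].
pose d := Num.min (s - normc w) (e / (L + 1)).
have L1 : 0 < L + 1 by rewrite ltr_wpDl.
have d0 : 0 < d by rewrite lt_min subr_gt0 ws divr_gt0.
exists d%:C; first by rewrite /= ltcR.
move=> h /=; rewrite sub0r normrN norm_normc ltcR => hd h0.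
have hw : normc (h + w) <= s.
  apply: (le_trans (normcD _ _)); rewrite -lerBrDr.
  by apply: (le_trans (ltW hd)); rewrite ge_min lexx.
rewrite (gE (h + w)) ?(le_lt_trans hw)// (gE w)// subrr mul0r subr0 addrK.
rewrite /GRing.scale /= mulKf// norm_normc lecR.
apply: (le_trans (pseries_lipschitz qM (ltW ws) hw sr)).
rewrite -/L opprD addrCA subrr addr0 normcNC.
have he : normc h <= e / (L + 1).
  by apply: (le_trans (ltW hd)); rewrite ge_min lexx orbT.
rewrite ler_pdivlMr// in he.
apply: le_trans he; rewrite mulrC ler_wpM2l ?normc_ge0//.
by rewrite lerDl.
Qed.

End PowerSeries.

(** * Compactness of the disc, Cauchy's estimate, inverses of polynomials *)

Section Disc.
Variable R : realType.
Implicit Types (u h : nat -> R[i]) (z w : R[i]) (rho M B s : R).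

(** Compactness of the closed unit disc, in the form of a finite cover by balls
    of prescribed, point-dependent radii. *)
Lemma disc_cover (e : R[i] -> R) : (forall w, normc w <= 1 -> 0 < e w) ->
  exists s : seq R[i], forall z, normc z <= 1 ->
    exists w, [/\ w \in s, normc w <= 1 & normc (z - w) < e w].
Proof.
move=> e0.
(* Compactness is that of the square [-1, 1] x [-1, 1].  Centres outside the
disc get a ball that misses the disc, and the factor 1/2 passes from the
max-norm of R * R to the modulus. *)
pose e' (p : R * R) := (if normc (p.1 +i* p.2) <= 1 then e (p.1 +i* p.2)
  else normc (p.1 +i* p.2) - 1) / 2.
have e'0 p : 0 < e' p.
  rewrite /e' divr_gt0//; case: ifPn => [/e0//|].
  by rewrite -ltNge subr_gt0.
have : compact (`[-1, 1]%classic `*` `[-1, 1]%classic : set (R * R)).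
  by apply: compact_setX; exact: segment_compact.
(* The filter of the statements that hold for all large enough finite lists
of centres. *)
pose F : set_system (seq (R * R)) :=
  fun A => exists s0 : seq (R * R), forall s : seq (R * R), {subset s0 <= s} -> A s.
have FF : Filter F.
  split; first by exists [::].
    move=> A B [s1 h1] [s2 h2]; exists (s1 ++ s2) => s ss; split.
      by apply: h1 => p ps; apply: ss; rewrite mem_cat ps.
    by apply: h2 => p ps; apply: ss; rewrite mem_cat ps orbT.
  by move=> A B AB [s0 h]; exists s0 => s /h /AB.
move=> /compact_near_coveringP /(_ _ F
  (fun (s : seq (R * R)) (q : R * R) => exists2 p, p \in s & ball p (e' p) q) FF) [].
  move=> p _; exists (ball p (e' p), [set s : seq (R * R) | p \in s]) => /=.
    split; first exact: nbhsx_ballx.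
    by exists [:: p] => s; apply; rewrite mem_head.
  by move=> [q s] [/= pq ps]; exists p.
move=> D cD; exists [seq p.1 +i* p.2 | p <- D] => z z1.
have [|p pD] := cD _ (fun _ => id) (Re z, Im z).
  have := normc_Re z; have := normc_Im z.
  by split; rewrite /= in_itv /= -ler_norml; lra.
rewrite /ball /= /prod_ball /ball /= => -[h1 h2].
have hz : normc (z - (p.1 +i* p.2)) < 2 * e' p.
  case: z z1 h1 h2 => x y _ /= h1 h2.
  apply: (le_lt_trans (normc_ReIm (x - p.1) (y - p.2))).
  by rewrite (distrC x) (distrC y); lra.
move: hz; rewrite /e' mulrCA divff// mulr1.
have := map_f (fun p => p.1 +i* p.2) pD; move: (p.1 +i* p.2) => w ws.
have [w1 hz|w1] := leP (normc w) 1; first by exists w.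
by rewrite normcB => /(le_lt_trans (ler_normcB _ _)) h; lra.
Qed.

(** In characteristic 0 the polynomial X^n - 1 is separable, so over a closed field
    it has n distinct roots, and such a set of n-th roots of unity contains a
    primitive one. *)
Lemma prim_root_exists (F : numClosedFieldType) n : (0 < n)%N ->
  exists w : F, n.-primitive_root w.
Proof.
move=> n0; have [rs] := closed_field_poly_normal ('X^n - 1 : {poly F}).
rewrite (monicP (monicXnsubC 1 n0)) scale1r => rsE.
have rs_uniq : uniq rs.
  by rewrite -separable_prod_XsubC -rsE separable_Xn_sub_1// pnatr_eq0 -lt0n.
have rs_roots : all n.-unity_root rs.
  by apply/allP => w; rewrite -root_prod_XsubC -rsE.
have rs_size : (n <= size rs)%N.
  by rewrite -ltnS -(size_prod_XsubC rs id) -rsE size_XnsubC.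
by have /hasP[w _ wn] := has_prim_root n0 rs_roots rs_uniq rs_size; exists w.
Qed.

(** Orthogonality of the powers of a primitive N-th root of unity w: the sum over
    j of w^(j (N - n + k)) is N if k = n, and 0 for the other k < N. *)
Lemma root_average (F : fieldType) (h : nat -> F) N (w : F) n :
  N.-primitive_root w -> (n < N)%N ->
  \sum_(j < N) (w ^+ j) ^+ (N - n) * (\sum_(0 <= k < N) h k * (w ^+ j) ^+ k) =
    N%:R * h n.
Proof.
move=> wN nN.
under eq_bigr do rewrite big_mkord mulr_sumr.
rewrite exchange_big /= (bigD1 (Ordinal nN)) //= [X in _ + X]big1 ?addr0 => [|k kn].
  rewrite (eq_bigr (fun=> h n)) => [|j _].
    by rewrite big_const_ord iter_addr_0 mulr_natl.
  rewrite mulrCA -exprD subnK ?(ltnW nN)// -exprM mulnC exprM (prim_expr_order wN).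
  by rewrite expr1n mulr1.
pose y := w ^+ (N - n + k).
rewrite (eq_bigr (fun j : 'I_N => h k * y ^+ j)) => [|j _]; last first.
  by rewrite mulrCA -exprD -!exprM mulnC.
rewrite -mulr_sumr.
suff -> : \sum_(j < N) y ^+ j = 0 by rewrite mulr0.
have y1 : y - 1 != 0.
  rewrite subr_eq0 /y -(prim_order_dvd wN); apply: contra kn => d.
  apply/eqP/val_inj => /=; have := ltn_ord k.
  have [c E] := dvdnP d; case: c E => [|[|c]] E; nia.
apply: (mulfI y1); rewrite -subrX1 mulr0 /y -exprM mulnC exprM (prim_expr_order wN).
by rewrite expr1n subrr.
Qed.

Lemma small_geometric (M q e : R) : 0 <= q -> q < 1 -> 0 < e ->
  exists n0, forall n, (n0 <= n)%N -> M * (q ^+ n / (1 - q)) <= e.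
Proof.
move=> q0 q1 e0.
have /cvgRP /(_ e e0) [n0 Hn0] : geometric (M / (1 - q)) q @ \oo --> (0 : R).
  by apply: cvg_geometric; rewrite ger0_norm.
exists n0 => n /Hn0; rewrite sub0r normrN /= => h; apply: le_trans h.
by apply: le_trans (ler_norm _); rewrite mulrAC mulrA.
Qed.

(** The n-th coefficient of the partial sum of order N is an average of its values
    at the N-th roots of unity, up to unimodular factors; then N tends to infinity. *)
Lemma cauchy_estimate rho M B h : 1 < rho -> geo_bound rho M h ->
  (forall z, normc z = 1 -> normc (pseries h z) <= B) ->
  forall n, normc (h n) <= B.
Proof.
move=> r1 hM hB n; apply/ler_addgt0Pr => e e0.
have [_ q0 q1] := ratio_bounds ler01 r1.
have [n0 Hn0] := small_geometric M q0 q1 e0.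
pose N := (n0 + n).+1; have nN : (n < N)%N by rewrite ltnS leq_addl.
have [w wN] := @prim_root_exists R[i] N isT.
have w1 : normc w = 1.
  apply/eqP; rewrite -(@pexpr_eq1 _ (normc w) N) ?normc_ge0//.
  by rewrite -normcX prim_expr_order// normc1.
have wj j : normc (w ^+ j) = 1 by rewrite normcX w1 expr1n.
have wj' j : normc (w ^+ j) <= 1 by rewrite wj.
have S j : normc (psum h (w ^+ j) N) <= B + e.
  have [_ /(_ N) a1] := psum_cvg hM (wj' j) r1.
  have := Hn0 N ltac:(rewrite /N; lia); have := hB _ (wj j).
  have := normcD (pseries h (w ^+ j)) (psum h (w ^+ j) N - pseries h (w ^+ j)).
  rewrite addrC subrK (normcB (psum _ _ _)); lra.
have N0 : (0 : R) < N%:R by rewrite ltr0n.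
rewrite -(ler_pM2l N0) -[X in X * normc _](@ger0_norm _ (N%:R))// -normcR -normcM.
rewrite rmorph_nat -(root_average h wN nN).
apply: (le_trans (normc_sum _ _ _)).
apply: (@le_trans _ _ (\sum_(j < N) (B + e))); last first.
  by rewrite big_const_ord iter_addr_0 mulr_natl.
by apply: ler_sum => j _; rewrite normcM normcX wj expr1n mul1r; exact: S.
Qed.

Lemma geo_bound_const rho c : geo_bound rho (normc c) (fun n => c * conv_one n).
Proof.
move=> [|n]; first by rewrite conv_one0 expr0 !mulr1.
by rewrite conv_oneS mulr0 normc0 mul0r normc_ge0.
Qed.

Lemma pseries_const c z : pseries (fun n => c * conv_one n) z = c.
Proof.
apply: pseries_eq; rewrite -cvg_shiftS.
rewrite (_ : (fun n => _) = (fun=> c)); first exact: cvg_cst.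
apply/funext => n; rewrite /psum big_nat_recl//= big1 => [|i _].
  by rewrite conv_one0 expr0 !mulr1 addr0.
by rewrite conv_oneS mulr0 mul0r.
Qed.

(** Division by X - w when w lies outside the disc of radius rho: the recursion
    g_n = (g_(n-1) - h_n) / w is contracting relative to rho^(-n). *)
Lemma mulXsub_preimage rho M h w : 0 < rho -> rho < normc w -> geo_bound rho M h ->
  exists2 g, geo_bound rho (M / (normc w - rho)) g & mulXsub w g = h.
Proof.
move=> r0 rw hM; have w0 : w != 0 by rewrite -normc_gt0 (lt_trans r0).
pose g := fix g n := ((if n is m.+1 then g m else 0) - h n) / w.
have gE n : g n = ((if n is m.+1 then g m else 0) - h n) / w by case: n.
exists g; last first.
  by apply/funext => n; rewrite /mulXsub gE mulrCA divff// mulr1 opprB addrCA subrr addr0.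
have M0 := geo_bound_ge0 hM; have d0 : 0 < normc w - rho by rewrite subr_gt0.
have w0' : 0 < normc w by rewrite normc_gt0.
elim=> [|n IH]; rewrite gE normcM normcV -mulrA mulrCA mulrC ler_pdivrMr//.
  rewrite sub0r normcNC; apply: (le_trans (hM 0%N)).
  by rewrite mulrAC ler_pdivlMr// ler_wpM2l// gerBl ltW.
have r0n : 0 <= rho ^+ n.+1 by rewrite exprn_ge0// ltW.
have h1 := ler_wpM2r r0n (normcD (g n) (- h n.+1)).
apply: (le_trans h1); rewrite mulrDl normcNC.
have h2 := hM n.+1; have h3 : normc (g n) * rho ^+ n.+1 <= M / (normc w - rho) * rho.
  by rewrite exprSr mulrA ler_wpM2r// ltW.
have -> : M / (normc w - rho) * normc w = M / (normc w - rho) * rho + M.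
  by field; rewrite gt_eqF.
exact: lerD.
Qed.

Lemma coef_XsubCM (F : fieldType) (w : F) (p : {poly F}) :
  (fun n => (('X - w%:P) * p)`_n) = mulXsub w (fun n => p`_n).
Proof.
by apply/funext => -[|n]; rewrite mulrBl coefB coefXM coefCM.
Qed.

(** A polynomial without zeros in |z| <= tau is, up to a constant, a product of
    factors X - w with |w| > tau, which are inverted one at a time. *)
Lemma poly_inverse (p : {poly R[i]}) tau : 1 < tau ->
  (forall z, normc z <= tau -> p.[z] != 0) ->
  exists h, [/\ exists rho M, 1 < rho /\ geo_bound rho M h,
    conv h (fun n => p`_n) = conv_one &
    forall z, normc z <= 1 -> p.[z] * pseries h z = 1].
Proof.
move=> t1 p0; have [r pE] := closed_field_poly_normal p.
set c := lead_coef p in pE.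
have rt : all (fun w => tau < normc w) r.
  apply/allP => w wr; rewrite ltNge; apply/negP => /p0; rewrite pE hornerZ.
  by rewrite (_ : (\prod_(z <- r) _).[w] = 0) ?mulr0 ?eqxx//;
    apply/rootP; rewrite root_prod_XsubC.
have c0 : c != 0.
  have := p0 0 ltac:(rewrite normc0; lra); apply: contraNneq => c0.
  by rewrite pE c0 scale0r horner0.
(* One rate of decay for all the factors. *)
pose rho := (1 + tau) / 2.
have r1 : 1 < rho by rewrite /rho; lra.
have r2 : rho < tau by rewrite /rho; lra.
have r0 : 0 < rho by lra.
suff [h [M hM] [h1 h2]] : exists2 h, exists M, geo_bound rho M h &
    conv h (fun n => p`_n) = conv_one /\
    forall z, normc z <= 1 -> p.[z] * pseries h z = 1.
  by exists h; split=> //; exists rho, M.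
clearbody c; rewrite pE => {p p0 pE}; elim: r rt => [_|w r IH /=].
  exists (fun n => c^-1 * conv_one n); first by exists (normc c^-1); exact: geo_bound_const.
  rewrite big_nil alg_polyC; split=> [|z _]; last first.
    by rewrite pseries_const hornerC divff.
  rewrite convC; apply/funext => n; rewrite /conv big_ord_recl /= big1 => [|i _].
    by rewrite coefC/= subn0 mulrA divff// mul1r addr0.
  by rewrite coefC/= mul0r.
move=> /andP[tw /IH [h [M hM] [h1 h2]]].
have rw : rho < normc w by apply: lt_trans tw.
have [g gM gh] := mulXsub_preimage r0 rw hM.
exists g; first by eexists; exact: gM.
rewrite big_cons -mul_polyC mulrCA mul_polyC coef_XsubCM; split=> [|z z1].
  by rewrite conv_mulXsub convC -conv_mulXsub gh convC.
rewrite hornerM hornerXsubC mulrAC -(pseries_mulXsub w gM (le_lt_trans z1 r1)) gh.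
by rewrite mulrC h2.
Qed.

End Disc.

(** * Inverses of power series without zeros, or with simple zeros on the circle *)

Section Inverse.
Variable R : realType.
Implicit Types (u f : nat -> R[i]) (z w : R[i]) (rho M B s : R).

Lemma nonzero_near rho M u w : 1 < rho -> geo_bound rho M u -> normc w <= 1 ->
  pseries u w != 0 -> exists2 d : R, 0 < d &
    forall z, normc z <= 1 -> normc (z - w) < d ->
      normc (pseries u w) / 2 <= normc (pseries u z).
Proof.
move=> r1 uM w1 uw0; have [_ q0 q1] := ratio_bounds ler01 r1.
pose L := M / (rho - 1) / (1 - 1 / rho).
have L0 : 0 <= L.
  by rewrite /L divr_ge0 ?divr_ge0 ?subr_ge0 ?(ltW r1) ?(ltW q1) ?(geo_bound_ge0 uM).
have L1 : 0 < L + 1 by rewrite ltr_wpDl.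
have uw : 0 < normc (pseries u w) by rewrite normc_gt0.
exists (normc (pseries u w) / 2 / (L + 1)); first by rewrite !divr_gt0.
move=> z z1; rewrite ltr_pdivlMr// => zw.
have := pseries_lipschitz uM z1 w1 r1; rewrite -/L.
have := ler_normcB (pseries u w) (pseries u z); rewrite (normcB (pseries u w)).
have : L * normc (z - w) <= normc (z - w) * (L + 1).
  by rewrite mulrC ler_wpM2l ?normc_ge0// lerDl.
lra.
Qed.

Lemma seq_min (T : eqType) (g : T -> R) (P : T -> bool) (s : seq T) :
  (forall x, P x -> 0 < g x) ->
  exists2 m : R, 0 < m & forall x, x \in s -> P x -> m <= g x.
Proof.
move=> g0; elim: s => [|x s [m m0 ms]]; first by exists 1.
have [px|npx] := boolP (P x).
  exists (Num.min m (g x)); first by rewrite lt_min m0 g0.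
  move=> y; rewrite inE => /orP[/eqP -> _|ys py]; first by rewrite ge_min lexx orbT.
  by rewrite ge_min ms.
exists m => // y; rewrite inE => /orP[/eqP ->|]; last exact: ms.
by rewrite (negbTE npx).
Qed.

(** Near each point w of the disc |f| >= |f(w)| / 2; finitely many such
    neighbourhoods cover. *)
Lemma min_on_disc rho M f : 1 < rho -> geo_bound rho M f ->
  (forall z, normc z <= 1 -> pseries f z != 0) ->
  exists2 m : R, 0 < m & forall z, normc z <= 1 -> m <= normc (pseries f z).
Proof.
move=> r1 fM f0.
have /choice [e He] : forall w, exists d : R, normc w <= 1 -> 0 < d /\
    forall z, normc z <= 1 -> normc (z - w) < d ->
      normc (pseries f w) / 2 <= normc (pseries f z).
  move=> w; have [w1|nw1] := boolP (normc w <= 1); last by exists 1.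
  by have [d d0 Hd] := nonzero_near r1 fM w1 (f0 _ w1); exists d.
have [s cs] := disc_cover (fun w hw => (He w hw).1).
have [|m m0 ms] := @seq_min _ (fun w => normc (pseries f w) / 2) (fun w => normc w <= 1) s.
  by move=> w w1; rewrite divr_gt0// normc_gt0 f0.
exists m => // z z1; have [w [ws w1 zw]] := cs z z1.
by apply: (le_trans (ms _ ws w1)); exact: (He w w1).2.
Qed.

(** The Lipschitz bound carries the lower bound from the unit circle to a slightly
    larger disc: a point z outside the unit disc is compared with z / |z|. *)
Lemma min_beyond_disc rho M f : 1 < rho -> geo_bound rho M f ->
  (forall z, normc z <= 1 -> pseries f z != 0) ->
  exists m tau : R, [/\ 0 < m, 1 < tau, tau < rho &
    forall z, normc z <= tau -> m <= normc (pseries f z)].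
Proof.
move=> r1 fM f0; have [m m0 mf] := min_on_disc r1 fM f0.
pose s := (1 + rho) / 2.
have s1 : 1 < s by rewrite /s; lra.
have sr : s < rho by rewrite /s; lra.
have s0 : 0 <= s by lra.
have [_ q0 q1] := ratio_bounds s0 sr.
pose L := M / (rho - s) / (1 - s / rho).
have L0 : 0 <= L.
  by rewrite /L divr_ge0 ?divr_ge0 ?subr_ge0 ?(ltW sr) ?(ltW q1) ?(geo_bound_ge0 fM).
have L1 : 0 < L + 1 by rewrite ltr_wpDl.
pose t := 1 + m / 2 / (L + 1).
have t1 : 1 < t by rewrite ltrDl !divr_gt0.
exists (m / 2), (Num.min s t); split; first by rewrite divr_gt0.
- by rewrite lt_min s1.
- by rewrite gt_min sr.
move=> z; rewrite le_min => /andP[zs zt].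
have [z1|z1] := leP (normc z) 1; first by have := mf z z1; lra.
have z0 : normc z != 0 by rewrite gt_eqF// (lt_trans ltr01).
pose w := z * ((normc z)^-1)%:C.
have w1 : normc w = 1.
  by rewrite normcM normcR ger0_norm ?invr_ge0 ?normc_ge0// divff.
have zw : normc (z - w) = normc z - 1.
  have -> : z - w = z * (1 - (normc z)^-1)%:C by rewrite rmorphB/= mulrBr mulr1.
  rewrite normcM normcR ger0_norm ?mulrBr ?mulr1 ?divff//.
  by rewrite subr_ge0 invf_le1 ?ltW// (lt_trans ltr01).
have ws : normc w <= s by rewrite w1 ltW.
have := pseries_lipschitz fM zs ws sr; rewrite -/L zw.
have := mf w ltac:(by rewrite w1); have := ler_normcB (pseries f w) (pseries f z).
rewrite (normcB (pseries f w)).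
have : (normc z - 1) * (L + 1) <= m / 2.
  by rewrite -ler_pdivlMr//; move: zt; rewrite /t; lra.
have : L * (normc z - 1) <= (normc z - 1) * (L + 1).
  by rewrite mulrC ler_wpM2l ?subr_ge0 ?(ltW z1)// lerDl.
lra.
Qed.

Lemma conv_scale u f s n :
  conv (fun k => u k * s%:C ^+ k) (fun k => f k * s%:C ^+ k) n =
  conv u f n * s%:C ^+ n.
Proof.
rewrite /conv mulr_suml; apply: eq_bigr => i _.
by rewrite mulrACA -exprD subnKC// -ltnS.
Qed.

(** The bound is obtained for the inverse of a polynomial truncation of f, which is
    known in advance to decay, with a constant independent of the truncation. *)
Lemma inverse_geometric rho M f : 1 < rho -> geo_bound rho M f ->
  (forall z, normc z <= 1 -> pseries f z != 0) ->
  exists r, conv r f = conv_one /\ exists s B, 1 < s /\ geo_bound s B r.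
Proof.
move=> r1 fM f0; have [m [t [m0 t1 tr mf]]] := min_beyond_disc r1 fM f0.
have f00 : f 0%N != 0.
  have := f0 0 ltac:(rewrite normc0; lra).
  by rewrite (pseries_shift fM) ?mul0r ?addr0// normc0; lra.
have [r rf] := inverse_exists f00; exists r; split=> //.
(* Half of the margin (in the logarithm) is spent on the rate of decay s, by the
scaling z -> s z; the other half leaves the scaled truncation free of zeros on
a disc of radius s > 1, as [poly_inverse] requires. *)
pose s := Num.sqrt t.
have s1 : 1 < s by rewrite -sqrtr1 ltr_sqrt//; lra.
have ss : s * s = t by rewrite -expr2 sqr_sqrtr//; lra.
have s0 : 0 <= s by lra.
exists s, (m / 2)^-1; split=> // n.
have t0 : 0 <= t by lra.
have [_ q0 q1] := ratio_bounds t0 tr.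
have [N HN] := @small_geometric R M (t / rho) (m / 2) q0 q1 ltac:(lra).
pose K := (N + n).+1.
pose p := \poly_(i < K) (f i * s%:C ^+ i).
have pE z : p.[z] = psum f (s%:C * z) K.
  rewrite horner_poly /psum big_mkord; apply: eq_bigr => i _.
  by rewrite exprMn mulrA.
have pm z : normc z <= s -> m / 2 <= normc p.[z].
  move=> zs; have szt : normc (s%:C * z) <= t.
    by rewrite normcM normcR ger0_norm// -ss ler_wpM2l.
  have [_ /(_ K) a1] := psum_cvg fM szt tr.
  have := HN K (leqW (leq_addr n N)); have := mf _ szt; rewrite pE.
  have := ler_normcB (pseries f (s%:C * z)) (pseries f (s%:C * z) - psum f (s%:C * z) K).
  rewrite subKr; lra.
have p0 z : normc z <= s -> p.[z] != 0.
  by move=> /pm h; rewrite -normc_gt0; lra.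
have [h [[rho' [M' [r1' hM]]] hp hz]] := poly_inverse s1 p0.
have hn : normc (h n) <= (m / 2)^-1.
  apply: (cauchy_estimate r1' hM) => z z1.
  have h1 := pm z ltac:(rewrite z1; lra).
  have := congr1 (@normc R) (hz z ltac:(by rewrite z1)).
  rewrite normcM normc1 => h2.
  have m2 : 0 < m / 2 by lra.
  rewrite -[leRHS]mul1r ler_pdivlMr// -[leRHS]h2 mulrC.
  by rewrite ler_wpM2r ?normc_ge0.
suff -> : normc (r n) * s ^+ n = normc (h n) by [].
rewrite -[s in LHS]ger0_norm// -normcR -normcX -normcM; congr normc.
apply: (@inverse_agree _ (fun k => r k * s%:C ^+ k) h
  (fun k => f k * s%:C ^+ k) (fun k => p`_k)) => //.
  by move=> k kn; rewrite coef_poly /K ltnS (leq_trans kn)// leq_addl.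
apply/funext => k; rewrite conv_scale rf; case: k => [|k].
  by rewrite conv_one0 expr0 mulr1.
by rewrite conv_oneS mul0r.
Qed.

Lemma divide_zero rho M f w : 1 < rho -> geo_bound rho M f -> normc w <= 1 ->
  pseries f w = 0 -> exists q, (exists M', geo_bound rho M' q) /\ f = mulXsub w q.
Proof.
move=> r1 fM w1 fw; have [q qM fE] := divide fM w1 r1.
exists q; split; first by eexists; exact: qM.
by rewrite fE fw; apply/funext => n; rewrite mul0r addr0.
Qed.

(** Simplicity of a zero as a property of factorisations, not of derivatives, so
    that it passes immediately from f = (X - w) q to q. *)
Definition simple_zero rho f z := forall M u, geo_bound rho M u -> f = mulXsub z u ->
  pseries u z != 0.

(** Induction on a list zs containing the zeros.  For a zero w, write
    f = (X - w) q and q = c + (X - w) t with c = q(w) <> 0; then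
    1/f = (1/(X - w) - t/q) / c, and 1/(X - w) has unimodular coefficients. *)
Lemma inverse_bounded_seq rho (zs : seq R[i]) : 1 < rho -> forall M f, geo_bound rho M f ->
  (forall z, normc z <= 1 -> pseries f z = 0 ->
    [/\ normc z = 1, z \in zs & simple_zero rho f z]) ->
  exists r, conv r f = conv_one /\ exists B, forall n, normc (r n) <= B.
Proof.
move=> r1; have r0 : 0 < rho by lra.
elim: zs => [|w zs IH] M f fM fz.
  have [z z1|r [rf [s [B [s1 rB]]]]] := inverse_geometric r1 fM.
    by apply/eqP => /(fz _ z1) [].
  exists r; split=> //; exists B => n; apply: le_trans (rB n).
  by rewrite ler_peMr ?normc_ge0// exprn_ege1// ltW.
have [/andP[w1 /eqP fw]|nw] := boolP ((normc w <= 1) && (pseries f w == 0)); last first.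
  apply: (IH M f fM) => z z1 fz0; have [h1 + h3] := fz z z1 fz0.
  rewrite inE => /orP[/eqP zw|//]; case/negP: nw.
  by rewrite -zw z1 fz0 eqxx.
have [w1' _ ws] := fz w w1 fw.
have [q [[M' qM] fE]] := divide_zero r1 fM w1 fw.
have qw := ws _ _ qM fE.
have [rq [rqq [B rB]]] : exists r, conv r q = conv_one /\ exists B, forall n, normc (r n) <= B.
  apply: (IH M' q qM) => z z1 qz.
  have fz0 : pseries f z = 0.
    by rewrite fE (pseries_mulXsub w qM) ?qz ?mulr0//; lra.
  have [h1 h2 h3] := fz z z1 fz0.
  have zw : z != w by apply: contraNneq qw => <-; rewrite qz.
  split=> //; first by move: h2; rewrite inE (negbTE zw).
  move=> M1 v vM qE; have := h3 _ _ (geo_bound_mulXsub w r0 vM).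
  rewrite fE qE mulXsubC => /(_ erefl); rewrite (pseries_mulXsub w vM); last by lra.
  by apply: contraNneq => ->; rewrite mulr0.
have [t tM qE] := divide qM w1 r1.
set c := pseries q w in qw qE.
have w0 : w != 0 by rewrite -normc_gt0 w1'.
(* 1/(X - w) *)
pose g n := - w^-1 ^+ n.+1.
have lg : mulXsub w g = conv_one.
  apply/funext => -[|n]; rewrite /mulXsub /g mulrN opprK.
    by rewrite expr1 mulfV// add0r.
  by rewrite [in X in w * X]exprS mulVKf// addNr.
(* t/q *)
pose k := conv t rq.
exists (fun n => c^-1 * (g n - k n)).
have lr : mulXsub w (fun n => c^-1 * (g n - k n)) = rq.
  have lt' : mulXsub w t = (fun n => q n - c * conv_one n).
    by apply/funext => n; rewrite [in RHS]qE addrK.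
  apply/funext => n.
  have -> : mulXsub w (fun n => c^-1 * (g n - k n)) n = c^-1 * (mulXsub w g n - mulXsub w k n).
    by case: n => [|n]; rewrite /mulXsub; ring.
  have -> : mulXsub w k n = conv_one n - c * rq n.
    rewrite /k convC -conv_mulXsub convC lt'.
    have -> : conv (fun n => q n - c * conv_one n) rq n = conv q rq n - c * conv conv_one rq n.
      rewrite /conv mulr_sumr -sumrB; apply: eq_bigr => i _.
      by rewrite mulrBl mulrA.
    by rewrite convC rqq convC conv1.
  by rewrite lg opprB addrCA subrr addr0 mulKf.
split; first by rewrite fE conv_mulXsub convC -conv_mulXsub lr convC.
exists (normc c^-1 * (1 + B * (M' / (rho - 1) / (1 - rho^-1)))) => n.
rewrite normcM ler_wpM2l ?normc_ge0//.
apply: (le_trans (normcD _ _)); rewrite lerD//.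
  by rewrite normcNC normcX normcV w1' invr1 expr1n.
by rewrite normcNC /k convC; exact: conv_bounded.
Qed.

(** Simple zeros are isolated, so by compactness the closed disc contains only
    finitely many zeros. *)
Lemma inverse_bounded rho M f : 1 < rho -> geo_bound rho M f ->
  (forall z, normc z <= 1 -> pseries f z = 0 -> normc z = 1 /\ simple_zero rho f z) ->
  exists r, conv r f = conv_one /\ exists B, forall n, normc (r n) <= B.
Proof.
move=> r1 fM fz.
have /choice [e He] : forall w, exists d : R, normc w <= 1 -> 0 < d /\
    forall z, normc z <= 1 -> normc (z - w) < d -> pseries f z = 0 -> z = w.
  move=> w; have [w1|nw1] := boolP (normc w <= 1); last by exists 1.
  have [fw|fw] := eqVneq (pseries f w) 0.
    have [q [[M' qM] fE]] := divide_zero r1 fM w1 fw.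
    have qw := (fz w w1 fw).2 _ _ qM fE.
    have [d d0 Hd] := nonzero_near r1 qM w1 qw; exists d => _; split=> // z z1 zd.
    rewrite fE (pseries_mulXsub w qM); last by lra.
    move/eqP; rewrite mulf_eq0 subr_eq0 => /orP[/eqP//|/eqP qz].
    have := Hd z z1 zd; rewrite qz normc0 => h.
    by move: qw; rewrite -normc_gt0 => h'; exfalso; lra.
  have [d d0 Hd] := nonzero_near r1 fM w1 fw; exists d => _; split=> // z z1 zd fz0.
  have := Hd z z1 zd; rewrite fz0 normc0 => h.
  by move: fw; rewrite -normc_gt0 => h'; exfalso; lra.
have [s cs] := disc_cover (fun w hw => (He w hw).1).
apply: (@inverse_bounded_seq rho s r1 M f fM) => z z1 fz0.
have [h1 h2] := fz z z1 fz0; split=> //.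
have [w [ws w1 zw]] := cs z z1.
by rewrite ((He w w1).2 z z1 zw fz0).
Qed.

End Inverse.

(** * The Volterra equation *)

Section Volterra.
Variable R : realType.
Implicit Types (a x r : nat -> R) (z w : R[i]).

(** If the limit superior is less than 1, then eventually |a_n|^(1/n) <= c < 1. *)
Lemma radius_gt1 a : (1 < radius_of_convergence a)%E ->
  exists rho M : R, 1 < rho /\ forall n, (1 <= n)%N -> `|a n| * rho ^+ n <= M.
Proof.
rewrite /radius_of_convergence; set L := limn_esup _ => L1.
have {L1} : (L < 1)%E.
  rewrite ltNge; apply/negP => L2; have := inve_gt1 (le_trans lee01 L2).
  by rewrite L1 ltNge L2.
move=> /ereal_inf_lt [y [V [n0 _ VN] <-]].
set y' := ereal_sup _ => y1.
have uy n : (n0 <= n)%N -> ((`|a n| `^ n%:R^-1)%:E <= y')%E.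
  by move=> nn; apply: ereal_sup_ubound; exists n => //; exact: VN.
have : (0 <= y')%E by apply: le_trans (uy n0 (leqnn _)); rewrite lee_fin powR_ge0.
move: y' y1 uy => [c| |]//; rewrite lte_fin lee_fin => c1 uy c0.
(* c may be 0, and the rate is the inverse of c'. *)
pose c' := (1 + c) / 2.
have c'0 : 0 < c' by rewrite /c'; lra.
have c'1 : c' < 1 by rewrite /c'; lra.
exists c'^-1, (1 + \sum_(i < n0) `|a i| * c'^-1 ^+ i).
split=> [|n n1]; first by rewrite invf_gt1.
have S0 : 0 <= \sum_(i < n0) `|a i| * c'^-1 ^+ i.
  by apply: sumr_ge0 => i _; rewrite mulr_ge0// exprn_ge0// invr_ge0 ltW.
have [nn|nn] := leqP n0 n.
  apply: (@le_trans _ _ 1); last by rewrite lerDl.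
  rewrite exprVn ler_pdivrMr ?exprn_gt0// mul1r.
  have := uy n nn; rewrite lee_fin => h.
  have -> : `|a n| = (`|a n| `^ n%:R^-1) ^+ n.
    by rewrite -powR_mulrn ?powR_ge0// -powRrM mulVf ?powRr1// pnatr_eq0 -lt0n.
  by rewrite lerXn2r ?nnegrE ?powR_ge0 ?(ltW c'0)// (le_trans h)// /c'; lra.
rewrite (bigD1 (Ordinal nn))//= addrCA lerDl addr_ge0// sumr_ge0// => i _.
by rewrite mulr_ge0// exprn_ge0// invr_ge0 ltW.
Qed.

Definition char_coefC a : nat -> R[i] := char_coef (fun n => (a n)%:C).

Lemma geo_bound_char_coef a : (1 < radius_of_convergence a)%E ->
  exists rho M, 1 < rho /\ geo_bound rho M (char_coefC a).
Proof.
move=> /radius_gt1 [rho [M [r1 aM]]]; exists rho, (Num.max 1 M); split=> // n.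
rewrite le_max; case: n => [|n]; first by rewrite normc1 expr0 mulr1 lexx.
by rewrite /char_coefC /char_coef normcNC normcR aM// orbT.
Qed.

Lemma char_fun_pseries a rho M z : geo_bound rho M (char_coefC a) -> normc z < rho ->
  char_fun a z = pseries (char_coefC a) z.
Proof.
move=> fM zr; have [uP _] := psum_cvg fM (lexx _) zr.
rewrite /char_fun; set s := (X in limn X).
suff : s @ \oo --> 1 - pseries (char_coefC a) z.
  by move=> /cvg_lim ->; [rewrite subKr|exact: norm_hausdorff].
rewrite -cvg_shiftS.
rewrite (_ : [sequence s n.+1]_n = (fun n => 1 - psum (char_coefC a) z n.+1)).
  apply: cvgB; first exact: cvg_cst.
  by rewrite (cvg_shiftS (psum (char_coefC a) z)).
apply/funext => n; rewrite /s /psum [in RHS]big_ltn//= expr0 mulr1 opprD addrA.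
rewrite subrr add0r -sumrN; apply: eq_big_nat => -[//|k] _.
by rewrite /char_coefC/= mulNr opprK.
Qed.

(** A solution is determined by its initial value, and the equation is linear. *)
Lemma is_solution_scale a x r : r 0%N = 1 -> is_solution a r -> is_solution a x ->
  forall n, x n = x 0%N * r n.
Proof.
move=> r0 rS xS n; elim/ltn_ind: n => -[|n] IH; first by rewrite r0 mulr1.
rewrite xS// rS// mulr_sumr; apply: eq_bigr => i _.
by rewrite IH// mulrCA.
Qed.

Lemma solution_scale a r c : is_solution a r -> is_solution a (fun n => c * r n).
Proof.
move=> rS n n1; rewrite rS// mulr_sumr; apply: eq_bigr => i _.
by rewrite mulrCA.
Qed.

Lemma resolvent_exists a : exists r, [/\ r 0%N = 1, is_solution a r &
  conv (fun n => (r n)%:C) (char_coefC a) = conv_one].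
Proof.
have [r r0 rS] := volterra_exists a; exists r; split=> //; first by case.
apply: conv_char_coef => [|n]; first by rewrite r0.
rewrite rS rmorph_sum; apply: eq_bigr => i _.
by rewrite rmorphM.
Qed.

Lemma null_stableP a r : r 0%N = 1 -> is_solution a r ->
  null_stable a <-> exists B, forall n, `|r n| <= B.
Proof.
move=> r0 rS; split=> [/(_ 1 ltr01) [d d0 Hd]|[B rB] e e0].
  exists (2 / d) => n; have d2 : 0 < d / 2 by rewrite divr_gt0.
  have := Hd _ (solution_scale (d / 2) rS); rewrite r0 mulr1 (ger0_norm (ltW d2)).
  move=> /(_ ltac:(lra) n); rewrite normrM (ger0_norm (ltW d2)) => h.
  by rewrite ler_pdivlMr//; lra.
have B0 : 0 <= B by apply: le_trans (rB 0%N).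
have B1 : 0 < B + 1 by lra.
exists (e / (B + 1)); first by rewrite divr_gt0.
move=> x xS; rewrite ltr_pdivlMr// => xd n.
rewrite (is_solution_scale r0 rS xS) normrM; apply: le_lt_trans xd.
by rewrite ler_wpM2l//; have := rB n; lra.
Qed.

Lemma null_asymptotically_stableP a r : r 0%N = 1 -> is_solution a r ->
  null_asymptotically_stable a <-> r @ \oo --> (0 : R).
Proof.
move=> r0 rS; split=> [[_ [d d0 Hd]]|rc].
  have d2 : 0 < d / 2 by rewrite divr_gt0.
  have := Hd _ (solution_scale (d / 2) rS); rewrite r0 mulr1 (ger0_norm (ltW d2)).
  move=> /(_ ltac:(lra)) h.
  have -> : r = (fun n => (d / 2)^-1 * (d / 2 * r n)).
    by apply/funext => n; rewrite mulKf// gt_eqF// divr_gt0.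
  by rewrite -(mulr0 (d / 2)^-1); apply: cvgM => //; exact: cvg_cst.
split; last first.
  exists 1 => // x xS _; rewrite (_ : x = fun n => x 0%N * r n).
    by rewrite -(mulr0 (x 0%N)); apply: cvgM => //; exact: cvg_cst.
  by apply/funext => n; exact: (is_solution_scale r0 rS xS).
apply/(null_stableP r0 rS); have /cvgP/cvg_seq_bounded/ex_strict_bound_gt0 [B B0 HB] := rc.
by exists B => n; apply/ltW; exact: HB.
Qed.

Lemma real_complex_cvg0 (r : nat -> R) :
  r @ \oo --> (0 : R) <-> (fun n => (r n)%:C) @ \oo --> (0 : R[i]).
Proof.
split=> [/cvgRP H|/cvgCP H]; [apply/cvgCP|apply/cvgRP] => e /H [n0 Hn];
  exists n0 => n /Hn; by rewrite !sub0r ?normcNC ?normcR normrN.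
Qed.

Section Necessity.
Variables (rho M : R) (f u : nat -> R[i]).
Hypotheses (rho1 : 1 < rho) (fM : geo_bound rho M f) (uf : conv u f = conv_one).

(** Since u f = 1 and f = (X - w) q, the product u q is 1/(X - w). *)
Lemma quotient_at_zero w : normc w <= 1 -> pseries f w = 0 ->
  exists q, [/\ exists M', geo_bound rho M' q, f = mulXsub w q, w != 0 &
    forall n, conv u q n = - w^-1 ^+ n.+1].
Proof.
move=> w1 fw; have [q [qM fE]] := divide_zero rho1 fM w1 fw.
have sE : mulXsub w (conv u q) = conv_one by rewrite -conv_mulXsub -fE.
have w0 : w != 0.
  apply: contra_eq_neq (congr1 (@^~ 0%N) sE) => ->.
  by rewrite /mulXsub sub0r mul0r oppr0 conv_one0 eq_sym oner_eq0.
exists q; split=> //; elim=> [|n IH].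
  have := congr1 (@^~ 0%N) sE; rewrite /mulXsub conv_one0 sub0r => /(canRL (@opprK _)) h.
  by apply: (mulfI w0); rewrite h mulrN expr1 mulfV.
have := congr1 (@^~ n.+1) sE; rewrite /mulXsub conv_oneS => /eqP; rewrite subr_eq0 => /eqP h.
by apply: (mulfI w0); rewrite -h IH mulrN [in RHS]exprS mulVKf.
Qed.

(** Otherwise the bounded sequence u q would grow like |w|^(-n). *)
Lemma no_zero_inside w B : (forall n, normc (u n) <= B) -> normc w < 1 ->
  pseries f w <> 0.
Proof.
move=> uB w1 fw; have [q [[M' qM] fE w0 sE]] := quotient_at_zero (ltW w1) fw.
have sB := conv_bounded rho1 uB qM; set B' := B * _ in sB.
have nw : 0 < normc w by rewrite normc_gt0.
have [n0 Hn0] := @small_geometric R (1 - normc w) (normc w) (B' + 1)^-1 (ltW nw) w1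
  ltac:(by rewrite invr_gt0 ltr_wpDl// (le_trans _ (sB 0%N)) ?normc_ge0).
have := Hn0 n0.+1 (leqnSn _); have := sB n0.
rewrite sE normcNC normcX normcV mulrCA divff ?subr_eq0 ?gt_eqF// mulr1 exprVn => h1 h2.
have p0 : 0 < normc w ^+ n0.+1 by rewrite exprn_gt0.
have : B' + 1 <= (normc w ^+ n0.+1)^-1.
  by rewrite -[leLHS]invrK lef_pV2// posrE invr_gt0; have := invr_ge0 (normc w ^+ n0.+1); lra.
lra.
Qed.

(** Otherwise u q would tend to 0, while its terms have modulus at least 1. *)
Lemma no_zero_on_disc w : u @ \oo --> (0 : R[i]) -> normc w <= 1 ->
  pseries f w <> 0.
Proof.
move=> u0 w1 fw; have [q [[M' qM] fE w0 sE]] := quotient_at_zero w1 fw.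
have /cvgCP /(_ (1 / 2) ltac:(lra)) [n0 Hn0] := conv_cvg0 rho1 u0 qM.
have := Hn0 n0 (leqnn _); rewrite sub0r normcNC sE normcNC normcX normcV.
have nw : 0 < normc w by rewrite normc_gt0.
have : 1 <= (normc w)^-1 ^+ n0.+1 by rewrite exprn_ege1// invf_ge1.
lra.
Qed.

(** If q(w) = 0 too, then f = (X - w)^2 v and u v = 1/(X - w)^2, whose n-th
    coefficient is (n + 1) w^(-n-2). *)
Lemma zero_on_circle_simple w B : (forall n, normc (u n) <= B) -> normc w = 1 ->
  pseries f w = 0 -> exists M' q, [/\ geo_bound rho M' q, f = mulXsub w q & pseries q w <> 0].
Proof.
move=> uB w1 fw; have w1' : normc w <= 1 by rewrite w1.
have [q [[M' qM] fE w0 sE]] := quotient_at_zero w1' fw.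
exists M', q; split=> // qw.
have [v [[M2 vM] qE]] := divide_zero rho1 qM w1' qw.
have tE : mulXsub w (conv u v) = conv u q by rewrite -conv_mulXsub -qE.
have cE n : conv u v n * w ^+ n.+2 = n.+1%:R.
  elim: n => [|n IH].
    have := congr1 (@^~ 0%N) tE; rewrite /mulXsub sE sub0r expr1 => /oppr_inj h.
    by rewrite expr2 mulrA (mulrC (conv u v 0%N)) h mulVf.
  have := congr1 (@^~ n.+1) tE; rewrite /mulXsub sE => /eqP.
  rewrite subr_eq addrC -subr_eq opprK => /eqP h.
  rewrite exprS mulrCA mulrA -h mulrDl IH exprVn mulVf ?expf_neq0//.
  by rewrite -[in RHS]natr1.
have sB := conv_bounded rho1 uB vM; set B' := B * _ in sB.
have h n : n.+1%:R <= B'.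
  have := congr1 (@normc R) (cE n); rewrite normcM normcX w1 expr1n mulr1.
  by rewrite -(rmorph_nat (real_complex R)) normcR ger0_norm// => <-; exact: sB.
have := h (Num.truncn B'); rewrite leNgt; move/negP; apply.
exact: truncnS_gt.
Qed.

End Necessity.
End Volterra.

Theorem theorem2 (R : realType) (a : nat -> R)
    (ha : (1 < radius_of_convergence a)%E) :
  (null_stable a <->
     (forall z : R[i], `|z| < 1 -> ~ char_root a z) /\
     (forall z : R[i], `|z| = 1 -> char_root a z ->
        zero_of_order 1 (char_fun a) z)) /\
  (null_asymptotically_stable a <->
     (forall z : R[i], `|z| <= 1 -> ~ char_root a z)).
Proof.
have [rho [M [rho1 fM]]] := geo_bound_char_coef ha.
have [r [r0 rS rf]] := resolvent_exists a.
have cE z : normc z < rho -> char_fun a z = pseries (char_coefC a) z.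
  exact: char_fun_pseries.
have n1 (z : R[i]) : (`|z| <= 1) = (normc z <= 1) by rewrite norm_normc -lecR.
have n2 (z : R[i]) : (`|z| < 1) = (normc z < 1) by rewrite norm_normc -ltcR.
have n3 (z : R[i]) : `|z| = 1 <-> normc z = 1.
  by rewrite norm_normc; split=> [[]|->].
split.
  rewrite (null_stableP r0 rS); split=> [[B rB]|[h1 h2]].
    have uB n : normc (r n)%:C <= B by rewrite normcR.
    split=> z; rewrite /char_root.
      rewrite n2 => z1; rewrite cE; last by lra.
      exact: (no_zero_inside rho1 fM rf uB).
    move=> /n3 z1; rewrite cE ?z1// => fz.
    have [M' [q [qM fE qz]]] := zero_on_circle_simple rho1 fM rf uB z1 fz.
    split; first by move=> -[|//] _ /=; rewrite /derive1n /= cE ?z1.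
    rewrite /derive1n /= (@derive1_pseries _ rho M' q)// ?z1// => w wr.
    by rewrite cE// fE (pseries_mulXsub z qM).
  have [z z1 fz|u [uf [B uB]]] := inverse_bounded rho1 fM.
    have [zlt|zge] := ltP (normc z) 1.
      have := h1 z; rewrite n2 zlt /char_root cE; last by lra.
      by move=> /(_ isT).
    have z1' : normc z = 1 by apply/eqP; rewrite eq_le z1 zge.
    split=> // M' q qM fE.
    have := h2 z ((n3 z).2 z1'); rewrite /char_root cE ?z1'// => /(_ fz) [_].
    rewrite /derive1n /= (@derive1_pseries _ rho M' q) ?z1'// => [/eqP//|w wr].
    by rewrite cE// fE (pseries_mulXsub z qM).
  exists B => n; rewrite -normcR.
  by have -> : (r n)%:C = u n by rewrite -(inverse_uniq rf uf).
rewrite (null_asymptotically_stableP r0 rS) real_complex_cvg0.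
split=> [rc z|h].
  rewrite n1 /char_root => z1; rewrite cE; last by lra.
  exact: (no_zero_on_disc rho1 fM rf rc).
have [z z1|u [uf [s [B [s1 uB]]]]] := inverse_geometric rho1 fM.
  apply/eqP => fz; apply: (h z); first by rewrite n1.
  by rewrite /char_root cE//; lra.
apply/cvgCP => e e0.
have [_ q0 q1] := ratio_bounds ler01 s1.
have [n0 Hn0] := small_geometric B q0 q1 e0.
exists n0 => n /Hn0; rewrite sub0r normcNC.
have -> : (r n)%:C = u n by rewrite -(inverse_uniq rf uf).
move=> h'; apply: le_trans h'.
apply: (le_trans (geo_boundE n _ uB)); first by lra.
rewrite ler_wpM2l ?(geo_bound_ge0 uB)// ler_pdivlMr ?subr_gt0// div1r.
by rewrite ler_piMr ?exprn_ge0 ?gerBl//; rewrite invr_ge0; lra.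
Qed.
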